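(* Let $s\ge 2$ be an integer and let $\vec t=(t_1,t_2,\dots)$ be a sequence with $t_j\in[-1,1]$ for all $j\ge1$. The generating function $\Theta(z,\vec t)=\sum_{k\ge 0}\zeta^{\vec t}(\{s\}_k)z^k$ is given, as a formal power series in $z$, by $$\Theta(z,\vec t)=\prod_{m=1}^\infty\Big(1+\frac{\frac{1}{m^s}\, z}{1-\frac{1}{m^s}\, z\, t_m}\Big)=\exp\Big(\sum_{j=1}^\infty\frac{z^j}{j}\Big(\zeta\big((\vec t^{\,j},js)\big)-\zeta\big(((\vec t-\vec 1)^j,js)\big)\Big)\Big).$$
   Context: For positive integers $i_1,\dots,i_k$ with $i_1\ge 2$ and a sequence $\vec t=(t_1,t_2,\dots)$ with $t_j\in[-1,1]$, the multi-interpolated multiple zeta value is $$\zeta^{\vec t}(i_1,\dots,i_k)=\sum_{\ell_1\ge\cdots\ge\ell_k\ge 1}\frac{\prod_{j=1}^\infty t_j^{\sigma_j(\ell_1,\dots,\ell_k)}}{\ell_1^{i_1}\cdots\ell_k^{i_k}},\qquad \sigma_j(\ell_1,\dots,\ell_k)=|\{1\le r\le k-1:\ \ell_r=\ell_{r+1}=j\}|,$$ with $t_j^0=1$. $\{s\}_k$ means $s$ repeated $k$ times, and $\zeta^{\vec t}(\{s\}_0)=1$. For an integer $j\ge 1$, $$\zeta\big((\vec t^{\,j},js)\big)=\sum_{m\ge 1}\frac{t_m^j}{m^{js}},\qquad \zeta\big(((\vec t-\vec 1)^j,js)\big)=\sum_{m\ge 1}\frac{(t_m-1)^j}{m^{js}}.$$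 The infinite product is understood as the coefficientwise limit of the finite products over $1\le m\le n$ (each factor expanded as a power series in $z$) as $n\to\infty$. *)

(* Defs.v *)
From HB Require Import structures.
From mathcomp Require Import all_boot all_order all_algebra.
From mathcomp Require Import all_classical all_reals all_analysis.
From mathcomp Require Import zify.

Set Implicit Arguments.
Unset Strict Implicit.
Unset Printing Implicit Defensive.
Import Order.TTheory GRing.Theory Num.Theory.
Import numFieldNormedType.Exports.
Local Open Scope classical_set_scope.
Local Open Scope ring_scope.

(* [f n] is the coefficient of z^n.  A record rather than [nat -> R] itself, on
   which the product would be the pointwise one. *)
Record fps (R : Type) := Fps { fps_coef :> nat -> R }.

HB.instance Definition _ (R : Type) := [isNew for @fps_coef R].
HB.instance Definition _ (R : choiceType) := [Choice of fps R by <:].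

Section FpsRing.
Variable R : fieldType.
Implicit Types f g h : fps R.

Lemma fpsP f g : (forall n, f n = g n) <-> f = g.
Proof.
by split=> [e|-> //]; case: f g e => f [g] /= e; congr Fps; apply/funext.
Qed.

Definition fps_zero := Fps (fun=> 0 : R).
Definition fps_opp f := Fps (fun n => - f n).
Definition fps_add f g := Fps (fun n => f n + g n).
Definition fps_scale (c : R) f := Fps (fun n => c * f n).
Definition fps_one := Fps (fun n => (n == 0%N)%:R : R).
Definition fps_mul f g := Fps (fun n => \sum_(i < n.+1) f i * g (n - i)%N).

Fact fps_addA : associative fps_add.
Proof. by move=> f g h; apply/fpsP => n /=; rewrite addrA. Qed.
Fact fps_addC : commutative fps_add.
Proof. by move=> f g; apply/fpsP => n /=; rewrite addrC. Qed.
Fact fps_add0 : left_id fps_zero fps_add.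
Proof. by move=> f; apply/fpsP => n /=; rewrite add0r. Qed.
Fact fps_addN : left_inverse fps_zero fps_opp fps_add.
Proof. by move=> f; apply/fpsP => n /=; rewrite addNr. Qed.

HB.instance Definition _ :=
  GRing.isZmodule.Build (fps R) fps_addA fps_addC fps_add0 fps_addN.

Definition fps_trunc N f : {poly R} := \poly_(i < N) f i.

Lemma fps_mul_trunc N f g n : (n < N)%N ->
  fps_mul f g n = (fps_trunc N f * fps_trunc N g)`_n.
Proof.
move=> nN; rewrite coefM /=; apply: eq_bigr => i _.
have iN : (i < N)%N by apply: leq_ltn_trans nN; rewrite -ltnS.
by rewrite !coef_poly iN (leq_ltn_trans (leq_subr _ _) nN).
Qed.

Fact fps_mulA : associative fps_mul.
Proof.
move=> f g h; apply/fpsP => n.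
transitivity ((fps_trunc n.+1 f * (fps_trunc n.+1 g * fps_trunc n.+1 h))`_n).
  rewrite coefM; apply: eq_bigr => i _.
  by rewrite -fps_mul_trunc ?ltnS ?leq_subr // coef_poly ltn_ord.
rewrite mulrA coefM; apply: eq_bigr => i _.
by rewrite -fps_mul_trunc // coef_poly ltnS leq_subr.
Qed.
Fact fps_mulC : commutative fps_mul.
Proof.
move=> f g; apply/fpsP => n.
by rewrite !(@fps_mul_trunc n.+1) // mulrC.
Qed.
Fact fps_mul1 : left_id fps_one fps_mul.
Proof.
move=> f; apply/fpsP => n /=.
rewrite big_ord_recl mul1r subn0 big1 ?addr0 // => i _.
by rewrite mul0r.
Qed.
Fact fps_mulDl : left_distributive fps_mul fps_add.
Proof.
move=> f g h; apply/fpsP => n /=; rewrite -big_split.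
by apply: eq_bigr => i _; rewrite mulrDl.
Qed.
Fact fps_1_neq_0 : fps_one != 0.
Proof.
by apply/eqP => /(congr1 (@fps_coef R))/(congr1 (@^~ 0%N))/eqP; rewrite oner_eq0.
Qed.

HB.instance Definition _ := GRing.Zmodule_isComNzRing.Build (fps R)
  fps_mulA fps_mulC fps_mul1 fps_mulDl fps_1_neq_0.

Fact fps_scaleA a b f :
  fps_scale a (fps_scale b f) = fps_scale (a * b) f.
Proof. by apply/fpsP => n /=; rewrite mulrA. Qed.
Fact fps_scale1 : left_id 1 fps_scale.
Proof. by move=> f; apply/fpsP => n /=; rewrite mul1r. Qed.
Fact fps_scaleDr : right_distributive fps_scale +%R.
Proof. by move=> c f g; apply/fpsP => n /=; rewrite mulrDr. Qed.
Fact fps_scaleDl f : {morph fps_scale^~ f : a b / a + b}.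
Proof. by move=> a b; apply/fpsP => n /=; rewrite mulrDl. Qed.

HB.instance Definition _ := GRing.Zmodule_isLmodule.Build R (fps R)
  fps_scaleA fps_scale1 fps_scaleDr fps_scaleDl.

Lemma fps_coefD f g n : (f + g) n = f n + g n. Proof. by []. Qed.
Lemma fps_coefN f n : (- f) n = - f n. Proof. by []. Qed.
Lemma fps_coefB f g n : (f - g) n = f n - g n. Proof. by []. Qed.
Lemma fps_coef0 n : (0 : fps R) n = 0. Proof. by []. Qed.
Lemma fps_coef1 n : (1 : fps R) n = (n == 0%N)%:R. Proof. by []. Qed.
Lemma fps_coefZ c f n : (c *: f) n = c * f n. Proof. by []. Qed.
Lemma fps_coefM f g n : (f * g) n = \sum_(i < n.+1) f i * g (n - i)%N.
Proof. by []. Qed.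
Lemma fps_coef_sum (I : Type) (r : seq I) (P : pred I) (F : I -> fps R) n :
  (\sum_(i <- r | P i) F i) n = \sum_(i <- r | P i) F i n.
Proof. by elim/big_rec2: _ => // i y x _ <-. Qed.

Definition fps_X : fps R := Fps (fun n => (n == 1%N)%:R).

(* The composite [\sum_n a n *: h ^+ n], meaningful when [h 0 = 0]: the powers
   [h ^+ n] with [n > k] then do not contribute to the coefficient of z^k. *)
Definition fps_comp (a h : fps R) : fps R :=
  Fps (fun k => \sum_(n < k.+1) a n * (h ^+ n) k).

Definition fps_exp (h : fps R) : fps R := fps_comp (Fps (fun n => (n`!%:R)^-1)) h.

(* For [f 0 != 0], [f = f 0 *: (1 - h)] with [h 0 = 0] is inverted by the
   geometric series in [h]. *)
Definition fps_inv f : fps R :=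
  if f 0%N == 0 then f
  else (f 0%N)^-1 *: fps_comp (Fps (fun=> 1)) (1 - (f 0%N)^-1 *: f).

Lemma fps_expr_small h n k : h 0%N = 0 -> (k < n)%N -> (h ^+ n) k = 0.
Proof.
move=> h0; elim: n k => // n IH k kn; rewrite exprS fps_coefM.
rewrite big1 // => -[[|i] /= ik] _; first by rewrite h0 mul0r.
by rewrite IH ?mulr0 //; lia.
Qed.

Lemma fps_scaleAl c f g : c *: (f * g) = (c *: f) * g.
Proof.
apply/fpsP => n; rewrite fps_coefZ !fps_coefM mulr_sumr.
by apply: eq_bigr => i _; rewrite mulrA.
Qed.

Fact fps_mulV f : f 0%N != 0 -> fps_inv f * f = 1.
Proof.
move=> f0; rewrite /fps_inv (negPf f0).
set h := 1 - _; set G := fps_comp _ _.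
have h0 : h 0%N = 0 by rewrite fps_coefB fps_coefZ mulVf // subrr.
rewrite -fps_scaleAl [G * f]mulrC fps_scaleAl.
have -> : (f 0%N)^-1 *: f = 1 - h by rewrite opprB addrCA subrr addr0.
apply/fpsP => k.
have GE i : (i <= k)%N -> G i = (\sum_(n < k.+1) h ^+ n) i.
  move=> ik; rewrite fps_coef_sum /G /=.
  rewrite (big_ord_widen k.+1 (fun n => 1 * (h ^+ n) i)) //.
  rewrite [RHS](bigID (fun n : 'I_k.+1 => (n < i.+1)%N)) /=.
  rewrite [X in _ = _ + X]big1 ?addr0; last first.
    by move=> n; rewrite -leqNgt => ?; rewrite fps_expr_small.
  by apply: eq_bigr => n _; rewrite mul1r.
transitivity (((1 - h) * \sum_(n < k.+1) h ^+ n) k).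
  by rewrite !fps_coefM; apply: eq_bigr => i _; rewrite GE // leq_subr.
rewrite -[1 - h]opprB mulNr -subrX1 opprB fps_coefB.
by rewrite fps_expr_small // subr0.
Qed.
Fact fps_unitP f g : g * f = 1 -> f 0%N != 0.
Proof.
move/(congr1 (fun h : fps R => h 0%N)); rewrite fps_coefM big_ord1.
by move=> e; apply/eqP => f0; move/eqP: e; rewrite f0 mulr0 eq_sym oner_eq0.
Qed.
Fact fps_inv_out : {in [predC [pred f : fps R | f 0%N != 0]], fps_inv =1 id}.
Proof. by move=> f; rewrite inE negbK /fps_inv => ->. Qed.

HB.instance Definition _ := GRing.ComNzRing_hasMulInverse.Build (fps R)
  fps_mulV fps_unitP fps_inv_out.

End FpsRing.

Arguments fps_X {R}.

Lemma fps_geometric (R : fieldType) (c : R) :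
  ((1 - c *: fps_X)^-1 : fps R) = Fps (fun n => c ^+ n).
Proof.
set g := Fps _.
have e : (1 - c *: fps_X) * g = 1.
  apply/fpsP => -[|n].
    by rewrite fps_coefM big_ord1 fps_coefB fps_coefZ /= mulr0 subr0 mulr1.
  rewrite fps_coefM !big_ord_recl big1 => [|i _];
    rewrite /= /bump /= ?fps_coefB ?fps_coefZ ?fps_coef1 /=
      ?mulr0 ?mulr1 ?subr0 ?mul0r //.
  by rewrite addr0 sub0r mul1r exprS mulNr subSS subn0 subrr.
have u : (1 - c *: fps_X : fps R) \is a GRing.unit by apply/unitrPr; exists g.
by apply: (mulrI u); rewrite e mulrV.
Qed.

Section Zeta.
Variable R : realType.

(* Sum of an absolutely summable real family; MathComp-Analysis sums over an
   arbitrary set only families of nonnegative terms. *)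
Definition rsum (T : choiceType) (D : set T) (f : T -> R) : R :=
  fine (\esum_(x in D) (EFin \o f)^\+ x - \esum_(x in D) (EFin \o f)^\- x)%E.

Definition chains (k : nat) : set (k.-tuple nat) :=
  [set l | sorted geq l /\ all (leq 1) l].

Definition sigma (j k : nat) (l : k.-tuple nat) : nat :=
  #|[pred r : 'I_k.-1 | (nth 0%N l r == j) && (nth 0%N l r.+1 == j)]|.

Lemma sigma_notin j k (l : k.-tuple nat) : j \notin l -> sigma j l = 0%N.
Proof.
move=> jl; apply: eq_card0 => r; rewrite inE; apply/negbTE.
apply: contra jl.
case: k l r => [|k] l r; first by case: r.
move=> /andP[/eqP <- _]; apply: mem_nth; rewrite size_tuple; exact: ltn_trans (ltn_ord r) _.
Qed.

(* The sequence t_1, t_2, ... is [t : nat -> R], whose value at 0 plays no role.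
   The product over all [j >= 1] has finite support. *)
Definition mzv (t : nat -> R) (k : nat) (i : k.-tuple nat) : R :=
  rsum (@chains k) (fun l =>
    (\big[*%R/1]_(j \in [set j | (1 <= j)%N]) t j ^+ sigma j l) /
    \prod_(r < k) (tnth l r)%:R ^+ tnth i r).

Lemma mzv_nil (t : nat -> R) (i : 0.-tuple nat) : mzv t i = 1.
Proof.
rewrite /mzv; set f := (fun l => _).
have f1 : f [tuple] = 1.
  rewrite /f big_ord0 divr1 fsbig1 // => j _.
  by rewrite sigma_notin // expr0.
rewrite /rsum.
have -> : @chains 0 = [set [tuple]].
  by apply/seteqP; split=> l //=; rewrite (tuple0 l).
rewrite !esum_set1 ?funepos_ge0 ?funeneg_ge0 // funeposE funenegE /= f1.
by rewrite -!EFin_max -EFinB /= !maxEle ler10 lerN10 subr0.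
Qed.

Definition zeta1 (u : nat -> R) (w : nat) : R :=
  limn (fun n => \sum_(1 <= m < n) u m / m%:R ^+ w).

Definition Theta (s : nat) (t : nat -> R) : fps R :=
  Fps (fun k => mzv t (nseq_tuple k s)).

Definition is_fps_prod (F : nat -> fps R) (P : fps R) : Prop :=
  forall k, (fun n => (\prod_(1 <= m < n.+1) F m : fps R) k) @ \oo --> P k.

End Zeta.

(* Main.v *)
(* With a_m = m^-s, the factor of index m is
   (1 - a_m (t_m - 1) z) / (1 - a_m t_m z).  Splitting chains according to
   whether they start with n+1, the sum over the chains of length k with entries
   at most n satisfies the recurrence in n and k that multiplication by this
   factor induces, so it is the coefficient of z^k in the n-th partial product;
   it converges to the multiple zeta value since the absolute values sum to at
   most (sum_m a_m)^k.

   For the exponential, let D = z d/dz.  Each factor F satisfies D F = G F with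
   G = sum_j a_m^j (t_m^j - (t_m - 1)^j) z^j, so the partial products satisfy
   D P = (sum_m G_m) P; in the limit D Theta = (D H) Theta, where H is the
   exponent.  This equation has a unique solution with constant coefficient 1,
   which is exp H. *)
Require Import Defs.
From mathcomp Require Import all_boot all_order all_algebra.
From mathcomp Require Import all_classical all_reals all_analysis.
From mathcomp Require Import ring lra zify.
Import Order.TTheory GRing.Theory Num.Theory.
Import numFieldNormedType.Exports.
Local Open Scope classical_set_scope.
Local Open Scope ring_scope.

(** * Formal differential equations for power series *)

(* The derivation z d/dz. *)
Definition fps_euler {R : fieldType} (f : fps R) : fps R :=
  Fps (fun n => n%:R * f n).

Lemma fps_coefMn {R : fieldType} (f : fps R) m n : (f *+ m) n = f n *+ m.
Proof. by elim: m => // m IH; rewrite !mulrS fps_coefD IH. Qed.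

Lemma fps_eulerM {R : fieldType} (f g : fps R) :
  fps_euler (f * g) = fps_euler f * g + f * fps_euler g.
Proof.
apply/fpsP => n; rewrite fps_coefD !fps_coefM /= mulr_sumr -big_split /=.
apply: eq_bigr => i _; have ni : n = (i + (n - i))%N by rewrite subnKC // -ltnS.
by rewrite {1}ni natrD; ring.
Qed.

Lemma fps_euler1 {R : fieldType} : fps_euler (1 : fps R) = 0.
Proof. by apply/fpsP => -[|n] /=; rewrite ?mul0r ?mulr0. Qed.

Lemma fps_eulerX {R : fieldType} (h : fps R) n :
  fps_euler (h ^+ n) = (h ^+ n.-1 * fps_euler h) *+ n.
Proof.
elim: n => [|n IH]; first by rewrite fps_euler1.
rewrite exprS fps_eulerM IH -mulrnAr; case: n {IH} => [|n] /=.
  by rewrite !mulr0 addr0 mulr1 mul1r.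
by rewrite [RHS]mulrSr mulrnAr mulrnAr mulrA -exprS addrC
  [fps_euler h * _]mulrC.
Qed.

(** Since [h ^+ n] has no terms below z^n, every long enough truncation gives the same coefficient.
    A truncation length independent of the coefficient makes the ring operations available. *)
Lemma fps_exp_coefE {R : fieldType} (h : fps R) N i : h 0%N = 0 -> (i < N)%N ->
  fps_exp h i = (\sum_(n < N) (n`!%:R)^-1 *: h ^+ n) i.
Proof.
move=> h0 iN; rewrite fps_coef_sum /=.
rewrite (big_ord_widen N (fun n => (n`!%:R)^-1 * (h ^+ n) i)) //= big_mkcond /=.
apply: eq_bigr => n _; case: ifPn => // ni.
by rewrite fps_expr_small ?mulr0 //; lia.
Qed.

(** Term by term, h^n/n! goes to h^(n-1)/(n-1)! times the derivative of h, so the truncation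
    [E N.+1] is sent to [E N * fps_euler h]. *)
Lemma fps_euler_exp {R : numFieldType} (h : fps R) : h 0%N = 0 ->
  fps_euler (fps_exp h) = fps_euler h * fps_exp h.
Proof.
move=> h0; apply/fpsP => k.
pose E N : fps R := \sum_(n < N) (n`!%:R)^-1 *: h ^+ n.
have eulerE N : fps_euler (E N.+1) = E N * fps_euler h.
  apply/fpsP => i; rewrite -[LHS]/(i%:R * E N.+1 i) fps_coef_sum mulr_sumr.
  rewrite big_ord_recl fps_coefZ fact0 invr1 mul1r expr0.
  rewrite -[_ * (1 : fps R) i]/(fps_euler 1 i) fps_euler1 add0r.
  rewrite mulr_suml fps_coef_sum.
  apply: eq_bigr => n _; rewrite fps_coefZ mulrCA.
  rewrite -[i%:R * _]/(fps_euler (h ^+ n.+1) i) fps_eulerX fps_coefMn.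
  rewrite -fps_scaleAl fps_coefZ lift0 factS natrM invfM.
  rewrite -[X in _ * X = _]mulr_natr.
  have n0 : (n.+1%:R : R) != 0 by rewrite pnatr_eq0.
  by rewrite [_^-1 / _]mulrC mulrACA mulVf // mulr1.
rewrite -[LHS]/(k%:R * fps_exp h k) (@fps_exp_coefE _ _ k.+1) // -/(E _).
rewrite -[LHS]/(fps_euler (E k.+1) k) eulerE mulrC !fps_coefM.
(* [E k] agrees with the exponential only below z^k; this suffices because [fps_euler h] has no
   constant term. *)
apply: eq_bigr => -[[|i] ik] _; first by rewrite /= !mul0r.
by rewrite (@fps_exp_coefE _ _ k) //=; lia.
Qed.

(** As [g 0 = 0], the equation expresses n times the n-th coefficient through earlier ones, and n >
    0 is invertible in characteristic zero. *)
Lemma fps_euler_uniq {R : numFieldType} (g f1 f2 : fps R) :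
  g 0%N = 0 -> f1 0%N = f2 0%N ->
  fps_euler f1 = g * f1 -> fps_euler f2 = g * f2 -> f1 = f2.
Proof.
move=> g0 f0 e1 e2; apply/fpsP => n.
elim/ltn_ind: n => -[//|n] IH.
have n0 : (n.+1%:R : R) != 0 by rewrite pnatr_eq0.
apply: (mulfI n0).
rewrite -[LHS]/(fps_euler f1 n.+1) -[RHS]/(fps_euler f2 n.+1) e1 e2.
rewrite !fps_coefM; apply: eq_bigr => -[[|i] ik] _ /=.
  by rewrite g0 !mul0r.
by rewrite IH //; lia.
Qed.

(** Logarithmic derivatives add up over a product; the relation is kept free of division. *)
Lemma fps_euler_prod {R : fieldType} (F G : nat -> fps R) n :
  (forall m, fps_euler (F m) = G m * F m) ->
  fps_euler (\prod_(1 <= m < n.+1) F m) =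
  (\sum_(1 <= m < n.+1) G m) * \prod_(1 <= m < n.+1) F m.
Proof.
move=> FG; elim: n => [|n IH].
  by rewrite !big_geq // fps_euler1 mul0r.
by rewrite !(big_nat_recr n.+1) //= fps_eulerM IH FG; ring.
Qed.

(** * Linear factors and the logarithmic derivative of one factor of the product *)

Lemma fps_coefMXr {R : fieldType} (f : fps R) c k :
  (f * (1 - c *: fps_X)) k = f k - (if k is k'.+1 then c * f k' else 0).
Proof.
rewrite mulrBr mulr1 fps_coefB mulrC -fps_scaleAl fps_coefZ fps_coefM.
congr (_ - _); case: k => [|k].
  by rewrite big_ord1 /= mul0r mulr0.
rewrite !big_ord_recl big1 ?addr0 /= => [|i _]; last by rewrite mul0r.
by rewrite mul0r mul1r add0r /bump /= subSS subn0.
Qed.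

Lemma fps_linear_unit {R : fieldType} (c : R) :
  (1 - c *: fps_X : fps R) \is a GRing.unit.
Proof.
apply/unitrPr; exists (Fps (fun n => c ^+ n)).
rewrite mulrC; apply/fpsP => -[|k]; rewrite fps_coefMXr /= ?subr0 //.
by rewrite exprS subrr.
Qed.

Lemma fps_factorE {R : fieldType} (a t : R) :
  (1 + (a *: fps_X) / (1 - (a * t) *: fps_X)) * (1 - (a * t) *: fps_X)
  = 1 - (a * (t - 1)) *: fps_X :> fps R.
Proof.
rewrite mulrDl mul1r divrK ?fps_linear_unit // mulrBr mulr1 scalerBl.
by rewrite opprB addrA addrAC.
Qed.

(** With u = atz and v = a(t-1)z, F = (1-v)/(1-u) has logarithmic derivative u/(1-u) - v/(1-v) =
    1/(1-u) - 1/(1-v), a difference of two geometric series. *)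
Lemma fps_euler_factor {R : fieldType} (a t : R) :
  let F : fps R := 1 + (a *: fps_X) / (1 - (a * t) *: fps_X) in
  fps_euler F =
  Fps (fun j => if j is 0%N then 0 else a ^+ j * (t ^+ j - (t - 1) ^+ j)) * F.
Proof.
move=> F; set G := Fps _.
set u := (a * t) *: fps_X : fps R; set v := (a * (t - 1)) *: fps_X : fps R.
have uU : (1 - u) \is a GRing.unit by exact: fps_linear_unit.
have vU : (1 - v) \is a GRing.unit by exact: fps_linear_unit.
have FE : F * (1 - u) = 1 - v by exact: fps_factorE.
have eulerX c : fps_euler (1 - c *: fps_X) = - (c *: fps_X) :> fps R.
  by apply/fpsP => -[|[|n]] /=; ring.
have GE : G = (1 - u)^-1 - (1 - v)^-1.
  rewrite !fps_geometric; apply/fpsP => -[|j]; rewrite /= ?subrr //.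
  by rewrite !exprMn mulrBr.
(* After multiplication by 1-u the two sides become Fu - v and F - 1, which agree because v = 1 -
   F(1-u). *)
apply: (mulIr uU).
have := congr1 fps_euler FE; rewrite fps_eulerM !eulerX -/u -/v => e.
have -> : fps_euler F * (1 - u) = F * u - v.
  by rewrite -[LHS](subrK (F * u)) -mulrN e addrC.
have -> : G * F * (1 - u) = F - 1.
  rewrite -mulrA FE GE mulrBl mulVr //; congr (_ - _).
  by rewrite -FE mulrC mulrK.
have -> : v = 1 - F * (1 - u) by rewrite FE; ring.
by ring.
Qed.

(** * Sums over chains with bounded entries *)

Lemma ler_fsum {R : realDomainType} {I : choiceType} (D : set I)
    (f g : I -> R) :
  finite_set D -> (forall i, D i -> f i <= g i) ->
  \sum_(i \in D) f i <= \sum_(i \in D) g i.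
Proof. by move=> finD fg; rewrite -lee_fin -!fsumEFin // lee_fsum. Qed.

Section ChainSums.
Context {R : realType}.

Definition chains_upto (n k : nat) : set (k.-tuple nat) :=
  [set l | chains l /\ all (geq n) l].

Definition mzv_term (t : nat -> R) (s k : nat) (l : k.-tuple nat) : R :=
  (\big[*%R/1]_(j \in [set j | (1 <= j)%N]) t j ^+ sigma j l) /
    \prod_(r < k) (tnth l r)%:R ^+ tnth (nseq_tuple k s) r.

Lemma chains_upto_nil n : chains_upto n 0 = [set [tuple]].
Proof. by apply/seteqP; split=> l //=; rewrite (tuple0 l). Qed.

Lemma chains_upto0 k : chains_upto 0 k.+1 = set0.
Proof.
apply/seteqP; split=> l //= -[[_]]; case/tupleP: l => x l /=.
by move=> /andP[x1 _] /andP[x0 _]; move: (leq_trans x1 x0).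
Qed.

(** The head is the largest entry, so it decides whether the bound n+1 is attained. The tail may
    start with n+1 again, hence keeps that bound. *)
Lemma chains_uptoS n k : chains_upto n.+1 k.+1 =
  chains_upto n k.+1 `|` (fun l => [tuple of n.+1 :: l]) @` chains_upto n.+1 k.
Proof.
apply/seteqP; split=> [l|l [|]].
- case/tupleP: l => x l [[/= xl /andP[x1 l1]] /andP[xn ln]].
  have lx : all (geq x) l by apply: order_path_min xl => // a b c; lia.
  have := xn; rewrite /= leq_eqVlt => /orP[/eqP xE|{}xn]; [right|left].
    exists l; last by apply: val_inj; rewrite /= xE.
    by split => //; split => //; exact: path_sorted xl.
  rewrite ltnS in xn; split; first by split=> //=; rewrite x1.
  by rewrite /= xn; apply: sub_all lx => a /= ax; exact: leq_trans ax xn.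
- by move=> [cl ln]; split=> //; apply: sub_all ln => a /= /leqW.
- move=> [l' [[sl' l'1] l'n] <-]; split=> /=; last by rewrite leqnn.
  by split=> /=; [rewrite path_min_sorted|].
Qed.

Lemma finite_chains_upto n k : finite_set (chains_upto n k).
Proof.
elim: k n => [|k IHk] n; first by rewrite chains_upto_nil.
elim: n => [|n IHn]; first by rewrite chains_upto0.
by rewrite chains_uptoS finite_setU; split => //; exact: finite_image.
Qed.

Lemma fsbig_chains_uptoS n k (f : k.+1.-tuple nat -> R) :
  \sum_(l \in chains_upto n.+1 k.+1) f l =
  \sum_(l \in chains_upto n k.+1) f l +
  \sum_(l \in chains_upto n.+1 k) f [tuple of n.+1 :: l].
Proof.
rewrite chains_uptoS fsbigU0.
- congr (_ + _); rewrite fsbig_image // => x y _ _ /(congr1 val) /= [xy].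
  exact: val_inj.
- exact: finite_chains_upto.
- by apply: finite_image; exact: finite_chains_upto.
- by move=> x [[_ xn] [l _ lx]]; move: xn; rewrite -lx /= ltnn.
Qed.

(** The only new adjacent pair is [x] with the head of [l]. For empty [l] the head defaults to 0,
    which differs from every [j >= 1]. *)
Lemma sigma_cons j x k (l : k.-tuple nat) : (1 <= j)%N ->
  sigma j [tuple of x :: l] = ((x == j) && (head 0%N l == j) + sigma j l)%N.
Proof.
move=> j1; case: k l => [|k] l.
  rewrite (tuple0 l) /= /sigma !eq_card0; [|by case..].
  by case: j j1 => // j _; rewrite andbF.
case/tupleP: l => y l.
rewrite /sigma -!sum1_card /= big_mkcond big_ord_recl /=; congr (_ + _)%N.
by rewrite [RHS]big_mkcond; apply: eq_bigr.
Qed.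

(** Indices above n do not occur in [l] and have exponent 0; an interval product allows its last
    factor to be split off. *)
Lemma mzv_weightE (t : nat -> R) n k (l : k.-tuple nat) : all (geq n) l ->
  \big[*%R/1]_(j \in [set j | (1 <= j)%N]) t j ^+ sigma j l =
  \prod_(1 <= j < n.+1) t j ^+ sigma j l.
Proof.
move=> ln; rewrite (fsbigE (index_iota 1 n.+1)) ?iota_uniq //.
- rewrite big_seq_cond [RHS]big_seq; apply: eq_bigl => j.
  rewrite mem_index_iota andbC; case: (boolP (0 < j < n.+1)%N) => //=.
    by case/andP=> j1 _; rewrite mem_set.
  by rewrite andbF.
- by move=> j /=; rewrite mem_index_iota => /andP[].
move=> j /= j1; rewrite mem_index_iota j1 /= -leqNgt => nj.
rewrite sigma_notin ?expr0 //; apply/negP => /(allP ln) /=.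
by rewrite leqNgt nj.
Qed.

(** Only the exponent of [t x] can change, and [x] is the last index of both weights because it
    bounds [l]. *)
Lemma mzv_term_cons (t : nat -> R) s x k (l : k.-tuple nat) :
  (1 <= x)%N -> all (geq x) l ->
  mzv_term t s _ [tuple of x :: l] =
  (x%:R ^+ s)^-1 * ((if head 0%N l == x then t x else 1) * mzv_term t s _ l).
Proof.
case: x => // x _ lx; rewrite /mzv_term.
rewrite (@mzv_weightE _ x.+1 _ l) // (@mzv_weightE _ x.+1 k.+1) /=; last first.
  by rewrite leqnn.
rewrite big_ord_recl.
rewrite (eq_big_nat _ _ (F2 := fun j =>
   t j ^+ ((x.+1 == j) && (head 0%N l == j)) * t j ^+ sigma j l)); last first.
  by move=> j /andP[j1 _]; rewrite sigma_cons // exprD.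
rewrite big_split /= big_nat_recr //= big_nat_cond big1 ?mul1r; last first.
  by move=> j /andP[/andP[_ jx] _]; rewrite gtn_eqF.
rewrite eqxx /= (tnth_nth 0%N) (tnth_nth s) /= invfM.
have -> : t x.+1 ^+ (head 0%N l == x.+1) =
    if head 0%N l == x.+1 then t x.+1 else 1.
  by case: ifP.
rewrite [RHS]mulrCA [X in _ = _ * X]mulrCA -!mulrA; congr (_ * (_ * (_ * _))).
congr (_^-1); apply: eq_bigr => r _; rewrite !tnth_nseq.
by rewrite !(tnth_nth 0%N).
Qed.

Definition mzv_upto (t : nat -> R) (s n k : nat) : R :=
  \sum_(l \in chains_upto n k) mzv_term t s k l.

Lemma mzv_term_nil (t : nat -> R) s : mzv_term t s 0 [tuple] = 1.
Proof.
rewrite /mzv_term big_ord0 divr1 fsbig1 // => j _.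
by rewrite sigma_notin // expr0.
Qed.

Lemma mzv_upto_nil t s n : mzv_upto t s n 0 = 1.
Proof. by rewrite /mzv_upto chains_upto_nil fsbig_set1 mzv_term_nil. Qed.

Lemma mzv_upto0 t s k : mzv_upto t s 0 k.+1 = 0.
Proof. by rewrite /mzv_upto chains_upto0 fsbig_set0. Qed.

Lemma head_chains_upto n k (l : k.-tuple nat) : chains_upto n k l ->
  (head 0 l <= n)%N.
Proof. by case=> _; case: (tval l) => //= x ? /andP[]. Qed.

(* A chain bounded by n+1 but not by n is n+1 followed by a chain l bounded by
   n+1; the difference on the right is the part of the sum where l itself starts
   with n+1, which is when the new entry contributes a factor t_(n+1). *)
Lemma mzv_uptoS t s n k : mzv_upto t s n.+1 k.+1 = mzv_upto t s n k.+1 +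
  (n.+1%:R ^+ s)^-1 *
    (t n.+1 * (mzv_upto t s n.+1 k - mzv_upto t s n k) + mzv_upto t s n k).
Proof.
rewrite [LHS]fsbig_chains_uptoS; congr (_ + _).
have -> : \sum_(l \in chains_upto n.+1 k) mzv_term t s _ [tuple of n.+1 :: l] =
    (n.+1%:R ^+ s)^-1 * \sum_(l \in chains_upto n.+1 k)
      ((if head 0%N l == n.+1 then t n.+1 else 1) * mzv_term t s _ l).
  rewrite mulr_fsumr; apply: eq_fsbigr => l; rewrite inE => -[_ ln].
  exact: mzv_term_cons.
congr (_ * _); case: k => [|k].
  (* For the empty chain both partial sums are 1, so the difference vanishes and no factor [t n.+1]
     arises. *)
  rewrite !mzv_upto_nil subrr mulr0 add0r chains_upto_nil fsbig_set1 /= mul1r.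
  exact: mzv_term_nil.
rewrite fsbig_chains_uptoS [in RHS]/mzv_upto fsbig_chains_uptoS.
rewrite [X in t _ * X]addrC addKr addrC; congr (_ + _).
  rewrite mulr_fsumr; apply: eq_fsbigr => l _ /=.
  by rewrite eqxx.
apply: eq_fsbigr => l; rewrite inE => /head_chains_upto ln.
by rewrite ltn_eqF ?mul1r.
Qed.

(** With weights of absolute value at most 1, the sum is dominated by part of the expansion of the
    k-th power. The uniform bound provides absolute convergence. *)
Lemma sum_normr_mzv_term_le (t : nat -> R) s n k :
  (forall j, (1 <= j)%N -> `|t j| <= 1) ->
  \sum_(l \in chains_upto n k) `|mzv_term t s k l| <=
  (\sum_(1 <= m < n.+1) (m%:R ^+ s)^-1) ^+ k.
Proof.
move=> t1.
have A0 n' : 0 <= \sum_(1 <= m < n'.+1) ((m%:R : R) ^+ s)^-1.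
  by apply: sumr_ge0 => m _; rewrite invr_ge0 exprn_ge0.
elim: k n => [|k IHk] n.
  by rewrite chains_upto_nil fsbig_set1 mzv_term_nil normr1 expr0.
elim: n => [|n IHn]; first by rewrite chains_upto0 fsbig_set0 exprn_ge0.
rewrite fsbig_chains_uptoS.
apply: (@le_trans _ _ ((\sum_(1 <= m < n.+1) (m%:R ^+ s)^-1) ^+ k.+1 +
    (n.+1%:R ^+ s)^-1 * (\sum_(1 <= m < n.+2) (m%:R ^+ s)^-1) ^+ k)).
  apply: lerD => //.
  apply: le_trans (ler_wpM2l _ (IHk n.+1)); last by rewrite invr_ge0 exprn_ge0.
  rewrite mulr_fsumr; apply: ler_fsum; first exact: finite_chains_upto.
  move=> l [_ ln]; rewrite mzv_term_cons // normrM normfV normrX normr_nat.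
  apply: ler_wpM2l; first by rewrite invr_ge0 exprn_ge0.
  rewrite normrM ler_piMl //; case: ifP => _; rewrite ?normr1 //.
  exact: t1.
(* With B = A + a, where a is the new term, A^(k+1) + a B^k <= A B^k + a B^k = B^(k+1). *)
set A := \sum_(1 <= m < n.+1) _; set B := \sum_(1 <= m < n.+2) _.
have BE : B = A + (n.+1%:R ^+ s)^-1 by rewrite /B (big_nat_recr n.+1).
rewrite [leRHS]exprS {2}BE mulrDl lerD2r exprS ler_wpM2l ?A0 //.
rewrite lerXn2r ?nnegrE ?A0 // BE lerDl invr_ge0 exprn_ge0 //.
Qed.

Lemma prod_factor_coefE (t : nat -> R) s n k :
  (\prod_(1 <= m < n.+1) (1 + ((m%:R ^+ s)^-1 *: fps_X)
     / (1 - ((m%:R ^+ s)^-1 * t m) *: fps_X)) : fps R) k = mzv_upto t s n k.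
Proof.
(* Equality of whole series is proved, so that the induction on n handles all coefficients at
   once. *)
rewrite -[RHS]/(Fps (mzv_upto t s n) k); congr (fps_coef _ k).
elim: n => [|n IH].
  rewrite big_geq //; apply/fpsP => -[|j] /=; first by rewrite mzv_upto_nil.
  by rewrite mzv_upto0.
rewrite big_nat_recr //= {}IH.
(* Clearing the denominator of the new factor turns the claim into the recurrence [mzv_uptoS]. *)
apply: (mulIr (fps_linear_unit ((n.+1%:R ^+ s)^-1 * t n.+1))).
rewrite -mulrA fps_factorE; apply/fpsP => -[|j]; rewrite !fps_coefMXr /=.
  by rewrite !mzv_upto_nil.
by rewrite mzv_uptoS; ring.
Qed.

End ChainSums.

(** * Passage to the limit *)

(** Every finite subset of the union lies in a single [D n], so the sum is the supremum of a
    nondecreasing sequence bounded by [C]. *)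
Lemma esum_nondecreasing_cvg {R : realType} {T : choiceType} (D : nat -> set T)
    (g : T -> R) (C : R) :
  (forall n, finite_set (D n)) -> (forall n, D n `<=` D n.+1) ->
  (forall x, 0 <= g x) -> (forall n, \sum_(x \in D n) g x <= C) ->
  \esum_(x in \bigcup_n D n) (g x)%:E \is a fin_num /\
  (\sum_(x \in D n) g x) @[n --> \oo] -->
    fine (\esum_(x in \bigcup_n D n) (g x)%:E).
Proof.
move=> finD nd g0 leC; set S := \esum_(x in _) _.
have D_mono : {homo D : m n / (m <= n)%N >-> m `<=` n}.
  move=> m n; elim: n => [|n IH]; first by rewrite leqn0 => /eqP ->.
  rewrite leq_eqVlt => /predU1P[-> //|mn].
  exact: subset_trans (IH mn) (nd n).
have sum_mono : nondecreasing_seq (fun n => \sum_(x \in D n) g x).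
  move=> m n mn; rewrite [leRHS](fsbigID (D m) (D n)) //= setIC
    (setIidl (D_mono _ _ mn)).
  by rewrite lerDl fsumr_ge0.
have SE : S = ereal_sup (range (fun n => (\sum_(x \in D n) g x)%:E)).
  apply/eqP; rewrite eq_le; apply/andP; split.
    apply: ge_ereal_sup => _ [A [finA AD] <-].
    have [n An] : exists n, A `<=` D n.
      have /choice[f fP] : forall x, exists n, A x -> D n x.
        move=> x; have [/AD[n _ Dn]|] := pselect (A x); first by exists n.
        by exists 0%N.
      have /finite_seqP[r Ar] := finA.
      exists (\max_(x <- r) f x)%N => x Ax.
      apply: D_mono (fP x Ax); apply: leq_bigmax_seq => //.
      by move: Ax; rewrite Ar.
    apply: (@le_trans _ _ (\sum_(x \in D n) g x)%:E); last first.
      by apply: ereal_sup_ubound; exists n.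
    rewrite fsumEFin // lee_fin (fsbigID A (D n)) //=.
    by rewrite setIC (setIidl An) lerDl fsumr_ge0.
  apply: ge_ereal_sup => _ [n _ <-]; apply: ereal_sup_ubound.
  exists (D n); first by split=> //; exact: bigcup_sup.
  by rewrite fsumEFin.
have Scvg : (\sum_(x \in D n) g x)%:E @[n --> \oo] --> S.
  rewrite SE; apply: ereal_nondecreasing_cvgn => m n mn.
  by rewrite lee_fin sum_mono.
have Sfin : S \is a fin_num.
  rewrite ge0_fin_numE; last by apply: esum_ge0 => x _; rewrite lee_fin.
  rewrite SE (@le_lt_trans _ _ C%:E) ?ltry //.
  by apply: ge_ereal_sup => _ [n _ <-]; rewrite lee_fin.
split=> //; move: Scvg; rewrite -[X in _ --> X]fineK // => /fine_cvg; exact.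
Qed.

(** The positive and negative parts are both dominated by [|f|], so each converges with a finite
    limit and the limits can be subtracted. *)
Lemma rsum_cvg {R : realType} {T : choiceType} (D : nat -> set T)
    (f : T -> R) (C : R) :
  (forall n, finite_set (D n)) -> (forall n, D n `<=` D n.+1) ->
  (forall n, \sum_(x \in D n) `|f x| <= C) ->
  (\sum_(x \in D n) f x) @[n --> \oo] --> rsum (\bigcup_n D n) f.
Proof.
move=> finD nd leC; rewrite /rsum.
pose p x := Num.max (f x) 0; pose q x := Num.max (- f x) 0.
have pE : (EFin \o f)^\+%E = EFin \o p.
  by apply/funext => x; rewrite funeposE /= -EFin_max.
have qE : (EFin \o f)^\-%E = EFin \o q.
  by apply/funext => x; rewrite funenegE /= -EFin_max.
have p0 x : 0 <= p x by rewrite /p le_max lexx orbT.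
have q0 x : 0 <= q x by rewrite /q le_max lexx orbT.
have pC n : \sum_(x \in D n) p x <= C.
  apply: le_trans (leC n); apply: ler_fsum => // x _.
  by rewrite /p ge_max ler_norm normr_ge0.
have qC n : \sum_(x \in D n) q x <= C.
  apply: le_trans (leC n); apply: ler_fsum => // x _.
  by rewrite /q ge_max -normrN ler_norm normr_ge0.
have [pfin pcvg] := esum_nondecreasing_cvg _ _ _ finD nd p0 pC.
have [qfin qcvg] := esum_nondecreasing_cvg _ _ _ finD nd q0 qC.
rewrite pE qE fineB //; apply: cvg_trans (cvgB pcvg qcvg).
apply: near_eq_cvg; near=> n => /=.
rewrite -[LHS]/(_ - _) !fsbig_finite //= -sumrB; apply: eq_bigr => x _.
by rewrite /p /q !maxEle; do 2 case: ifPn; lra.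
Unshelve. all: by end_near. Qed.

Lemma sum_inv_expn_le2 {R : realType} (s n : nat) : (2 <= s)%N ->
  \sum_(1 <= m < n.+1) ((m%:R : R) ^+ s)^-1 <= 2.
Proof.
move=> s2.
(* This sharper bound telescopes: 1/m^s <= 1/m^2 <= 1/(m-1) - 1/m for m >= 2. *)
suff H k : \sum_(1 <= m < k.+2) ((m%:R : R) ^+ s)^-1 <= 2 - k.+1%:R^-1.
  case: n => [|n]; first by rewrite big_geq.
  by apply: le_trans (H n) _; rewrite gerBl invr_ge0.
elim: k => [|k IH].
  by rewrite big_nat1 expr1n invr1; lra.
rewrite big_nat_recr //=.
have step : ((k.+2%:R : R) ^+ s)^-1 <= k.+1%:R^-1 - k.+2%:R^-1.
  have k1 : 0 < (k.+1%:R : R) by rewrite ltr0n.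
  have k2 : 0 < (k.+2%:R : R) by rewrite ltr0n.
  apply: (@le_trans _ _ ((k.+2%:R : R) ^+ 2)^-1).
    rewrite lef_pV2 ?posrE ?exprn_gt0 // ler_weXn2l // ler1n //.
  have -> : k.+1%:R^-1 - k.+2%:R^-1 = (k.+1%:R * k.+2%:R)^-1 :> R.
    by rewrite [k.+2%:R]mulrSr; field; rewrite -natr1 in k2 *; lra.
  rewrite lef_pV2 ?posrE ?exprn_gt0 ?mulr_gt0 //.
  by rewrite expr2 ler_wpM2r ?ler_nat // ltW.
by have := lerD IH step; rewrite addrA subrK.
Qed.

(** Absolute convergence by comparison with [M] times the sum of m^-w, which is at most 2. *)
Lemma zeta1_cvg {R : realType} (u : nat -> R) (w : nat) (M : R) : (2 <= w)%N ->
  (forall m, (1 <= m)%N -> `|u m| <= M) ->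
  (\sum_(1 <= m < n.+1) u m / m%:R ^+ w) @[n --> \oo] --> zeta1 u w.
Proof.
move=> w2 uM.
pose v m := u m / m%:R ^+ w.
have vS n : \sum_(1 <= m < n) v m = series v n.
  rewrite /series /=; case: n => [|n]; first by rewrite !big_geq.
  (* [series] starts at index 0, but that term is 0 since the inverse of 0 is 0. *)
  rewrite [RHS]big_ltn // /v expr0n; case: w w2 {v} => // w _.
  by rewrite invr0 mulr0 add0r.
suff vc : cvgn (series v).
  have eS : (fun n => \sum_(1 <= m < n) v m) = series v by exact/funext.
  rewrite -[zeta1 u w]/(limn (fun n => \sum_(1 <= m < n) v m)).
  by rewrite (cvg_shiftS (fun n => \sum_(1 <= m < n) v m)) eS.
have M0 : 0 <= M by apply: le_trans (uM 1%N isT).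
suff nv : cvgn (series (fun m => `|v m|)) by exact: normed_cvg nv.
apply: nondecreasing_is_cvgn.
  by apply/nondecreasing_seqP => n; rewrite seriesSr lerDl.
exists (M * 2) => _ [n _ <-].
apply: (@le_trans _ _ (\sum_(1 <= m < n.+1) `|v m|)).
  rewrite /series /=; case: n => [|n]; first by rewrite !big_geq.
  rewrite big_ltn // /v expr0n; case: w w2 {v vS} => // w _.
  by rewrite invr0 mulr0 normr0 add0r [leRHS]big_nat_recr //= lerDl.
apply: le_trans (ler_wpM2l M0 (@sum_inv_expn_le2 R w n w2)).
rewrite mulr_sumr; apply: ler_sum_nat => m /andP[m1 _].
by rewrite normrM normfV normrX normr_nat ler_wpM2r ?uM.
Qed.

Lemma chains_bigcup k : @chains k = \bigcup_n chains_upto n k.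
Proof.
apply/seteqP; split=> [l cl|l [n _ []]] //.
exists (\max_(x <- l) x)%N => //; split=> //.
by apply/allP => x xl; exact: leq_bigmax_seq.
Qed.

Lemma mzv_cvg {R : realType} (s : nat) (t : nat -> R) (k : nat) : (2 <= s)%N ->
  (forall j, (1 <= j)%N -> `|t j| <= 1) ->
  mzv_upto t s n k @[n --> \oo] --> mzv t (nseq_tuple k s).
Proof.
move=> s2 t1.
have -> : mzv t (nseq_tuple k s) =
    rsum (\bigcup_n chains_upto n k) (mzv_term t s k).
  by rewrite -chains_bigcup.
apply: (@rsum_cvg _ _ _ _ (2 ^+ k)) => n.
- exact: finite_chains_upto.
- by move=> l [cl ln]; split=> //; apply: sub_all ln => a /= /leqW.
- apply: le_trans (sum_normr_mzv_term_le _ _ _ _ t1) _.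
  rewrite lerXn2r ?nnegrE ?sum_inv_expn_le2 //.
  by apply: sumr_ge0 => m _; rewrite invr_ge0 exprn_ge0.
Qed.

(** * The product and exponential formulas *)

Theorem theorem2 (R : realType) (s : nat) (t : nat -> R)
  (hs : (2 <= s)%N)
  (ht : forall j : nat, (1 <= j)%N -> -1 <= t j <= 1) :
  is_fps_prod
    (fun m => 1 + ((m%:R ^+ s)^-1 *: fps_X)
                    / (1 - ((m%:R ^+ s)^-1 * t m) *: fps_X))
    (Theta s t)
  /\ Theta s t =
     fps_exp (Fps (fun j => if j is 0%N then 0 else
       j%:R^-1 * (zeta1 (fun m => t m ^+ j) (j * s)
                  - zeta1 (fun m => (t m - 1) ^+ j) (j * s)))).
Proof.
have t1 j : (1 <= j)%N -> `|t j| <= 1 by move/ht; rewrite ler_norml.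
set F := (fun m => _); set H := Fps _.
have Fprod : is_fps_prod F (Theta s t).
  move=> k; under eq_cvg do rewrite prod_factor_coefE.
  exact: mzv_cvg.
split=> //.
have H0 : H 0%N = 0 by [].
apply: (@fps_euler_uniq _ (fps_euler H)); last exact: fps_euler_exp.
- by rewrite /= mul0r.
- by rewrite /= mzv_nil big_ord1 /= fact0 invr1 mulr1.
apply/fpsP => k.
pose G m : fps R := Fps (fun j => if j is 0%N then 0 else
  (m%:R ^+ s)^-1 ^+ j * (t m ^+ j - (t m - 1) ^+ j)).
pose P n : fps R := \prod_(1 <= m < n.+1) F m.
have PE n : fps_euler (P n) = (\sum_(1 <= m < n.+1) G m) * P n.
  by apply: fps_euler_prod => m; exact: fps_euler_factor.
have Pcvg i : P n i @[n --> \oo] --> Theta s t i by exact: Fprod.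
have Gcvg i : (\sum_(1 <= m < n.+1) G m) i @[n --> \oo] --> fps_euler H i.
  under eq_cvg do rewrite fps_coef_sum.
  case: i => [|i].
    by apply: cvg_near_cst; apply: nearW => n; rewrite /= mul0r big1.
  have si : (2 <= i.+1 * s)%N by nia.
  have -> : fps_euler H i.+1 = zeta1 (fun m => t m ^+ i.+1) (i.+1 * s) -
      zeta1 (fun m => (t m - 1) ^+ i.+1) (i.+1 * s).
    by rewrite /= mulrA mulfV ?mul1r // pnatr_eq0.
  have tcvg := @zeta1_cvg R (fun m => t m ^+ i.+1) _ 1 si.
  (* Here t_m - 1 lies in [-2, 0], whence the bound [2 ^+ i.+1]. *)
  have t'cvg := @zeta1_cvg R (fun m => (t m - 1) ^+ i.+1) _ (2 ^+ i.+1) si.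
  apply: cvg_trans (cvgB (tcvg _) (t'cvg _)).
  - apply: near_eq_cvg; apply: nearW => n; rewrite -[LHS]/(_ - _) -sumrB.
    apply: eq_bigr => m _ /=.
    by rewrite -mulrBl mulrC exprVn -exprM mulnC.
  - by move=> m /t1 tm; rewrite normrX exprn_ile1.
  - move=> m /ht tm; rewrite normrX lerXn2r ?nnegrE //.
    by rewrite ler_norml; lra.
have c1 : fps_euler (P n) k @[n --> \oo] --> fps_euler (Theta s t) k.
  by apply: cvgM; [exact: cvg_cst|exact: Pcvg].
(* Each coefficient of a product is a finite sum, so coefficientwise limits multiply; comparison
   with [c1] gives the differential equation for [Theta s t]. *)
have c2 : fps_euler (P n) k @[n --> \oo] --> (fps_euler H * Theta s t) k.
  under eq_cvg do rewrite PE fps_coefM.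
  rewrite fps_coefM; apply: cvg_big => [|i _]; first exact: add_continuous.
  by apply: cvgM; [exact: Gcvg|exact: Pcvg].
by rewrite -(cvg_lim (@Rhausdorff R) c1) (cvg_lim (@Rhausdorff R) c2).
Qed.
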